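(* Let $V$ be a finite set and let $\mathcal{C}$ be a minimal set cover of $V$. From each set $C\in\mathcal{C}$ choose one loyal vertex of $C$ (an element of $V$ lying in $C$ and in no other member of $\mathcal{C}$). Let $S$ be the set of chosen vertices and $K=V\setminus S$. Let $G$ be the graph with vertex set $V$ in which distinct $u,v$ are adjacent if and only if either $u$ and $v$ lie together in some member of $\mathcal{C}$, or $u,v\in K$. Then $G$ is a split graph, and $G$ is an unbalanced split graph if and only if $\mathcal{C}$ is an unbalanced minimal set cover (equivalently, $G$ is balanced if and only if $\mathcal{C}$ is balanced).
   Context: A set cover of a finite set $V$ is a collection $\mathcal{C}$ of subsets of $V$ whose union is $V$; it is minimal if no member of $\mathcal{C}$ is contained in the union of the remaining members. A minimal set cover $\mathcal{C}$ of $V$ is unbalanced if it contains a set of cardinality $|V|-|\mathcal{C}|+1$, and balanced otherwise. A finite graph $G$ is a split graph if its vertex set can be partitioned as $K\cup S$ with $K$ a clique and $S$ a stable set (a $KS$-partition). Writing $\omega(G)$ for the clique number and $\alpha(G)$ for the independence number, a split graph is balanced if it has a $KS$-partition with $|K|=\omega(G)$ and $|S|=\alpha(G)$, and unbalanced otherwise. *)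

(* Defs.v *)
From mathcomp Require Import all_boot.

Set Implicit Arguments.
Unset Strict Implicit.
Unset Printing Implicit Defensive.

Section SetCovers.

Variable V : finType.
Implicit Types (C : {set {set V}}) (A : {set V}) (x : V).

Definition is_set_cover C : Prop := cover C = [set: V].

Definition minimal_set_cover C : Prop :=
  is_set_cover C /\ forall A, A \in C -> ~~ (A \subset cover (C :\ A)).

(* The subtraction does not truncate: members of a minimal set cover have
   distinct loyal elements, so #|C| <= #|V|. *)
Definition has_unbalancing_set C : Prop :=
  exists2 A, A \in C & #|A| = #|V| - #|C| + 1.

Definition unbalanced_cover C : Prop :=
  minimal_set_cover C /\ has_unbalancing_set C.

Definition balanced_cover C : Prop :=
  minimal_set_cover C /\ ~ has_unbalancing_set C.

Definition loyal C A x : Prop :=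
  x \in A /\ forall B, B \in C -> B != A -> x \notin B.

End SetCovers.

Record sgraph (V : finType) := SGraph {
  adj :> rel V;
  adj_sym : symmetric adj;
  adj_irr : irreflexive adj
}.

Section SplitGraphs.

Variables (V : finType) (G : sgraph V).
Implicit Types (K S : {set V}).

Definition clique K : bool :=
  [forall u in K, forall v in K, (u != v) ==> G u v].

Definition stable S : bool :=
  [forall u in S, forall v in S, ~~ G u v].

Definition clique_number : nat := \max_(K : {set V} | clique K) #|K|.

Definition independence_number : nat := \max_(S : {set V} | stable S) #|S|.

(* The parts may be empty. *)
Definition KS_partition K S : Prop :=
  [/\ K :|: S = [set: V], [disjoint K & S], clique K & stable S].

Definition split_graph : Prop := exists K S, KS_partition K S.

Definition has_balanced_KS_partition : Prop :=
  exists K S, [/\ KS_partition K S, #|K| = clique_number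
                & #|S| = independence_number].

Definition balanced_split_graph : Prop :=
  split_graph /\ has_balanced_KS_partition.

Definition unbalanced_split_graph : Prop :=
  split_graph /\ ~ has_balanced_KS_partition.

End SplitGraphs.

Section CoverGraph.

Variables (V : finType) (C : {set {set V}}) (K : {set V}).

Definition cover_adj : rel V := fun u v =>
  (u != v) &&
  ([exists A in C, (u \in A) && (v \in A)] || (u \in K) && (v \in K)).

Lemma cover_adj_sym : symmetric cover_adj.
Proof.
move=> u v; rewrite /cover_adj eq_sym [(u \in K) && _]andbC; congr (_ && (_ || _)).
by apply: eq_existsb => A; rewrite [(u \in A) && _]andbC.
Qed.

Lemma cover_adj_irr : irreflexive cover_adj.
Proof. by move=> u; rewrite /cover_adj eqxx. Qed.

Definition cover_graph : sgraph V := SGraph cover_adj_sym cover_adj_irr.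

End CoverGraph.

(* Main.v *)
Require Import Defs.
From mathcomp Require Import all_boot.

Set Implicit Arguments.
Unset Strict Implicit.
Unset Printing Implicit Defensive.

(** For a split graph with KS-partition [(K, S)], a clique with more than [#|K|]
    elements meets [S] in some [x], hence lies in the closed neighbourhood
    [N[x]], which is contained in [x |: K]; so [omega(G) > #|K|] exactly when
    [#|N[x]| = #|K| + 1] for some [x] in [S].  All KS-partitions with
    [#|S| = alpha(G)] have parts of the same sizes, so when [#|S| = alpha(G)]
    such an [x] exists exactly when [G] is unbalanced.

    In the cover graph the members of [C] are cliques covering [V], so that
    [alpha(G) <= #|C| = #|S|], and the closed neighbourhood of the vertex chosen
    in [A] is [A] itself.  The criterion thus asks for a member of [C] with
    [#|K| + 1 = #|V| - #|C| + 1] elements. *)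

Section CliquesAndStableSets.

Variables (V : finType) (G : sgraph V).
Implicit Types (Q I : {set V}) (C : {set {set V}}) (x : V).

Definition closed_neighbourhood x : {set V} := [set v | (v == x) || G x v].

Lemma cliqueP Q : reflect {in Q &, forall u v, u != v -> G u v} (clique G Q).
Proof.
apply: (iffP forall_inP) => [cQ u v /cQ/forall_inP cu /cu/implyP // | cQ u uQ].
by apply/forall_inP => v vQ; apply/implyP; apply: cQ.
Qed.

Lemma stableP I : reflect {in I &, forall u v, ~~ G u v} (stable G I).
Proof.
apply: (iffP forall_inP) => [sI u v /sI/forall_inP su /su // | sI u uI].
by apply/forall_inP => v; apply: sI.
Qed.

Lemma leq_clique_number Q : clique G Q -> #|Q| <= clique_number G.
Proof. exact: (@leq_bigmax_cond _ _ (fun Q => #|Q|)). Qed.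

Lemma leq_independence_number I : stable G I -> #|I| <= independence_number G.
Proof. exact: (@leq_bigmax_cond _ _ (fun I => #|I|)). Qed.

Lemma exists_max_clique : exists2 Q, clique G Q & #|Q| = clique_number G.
Proof.
have clique_gt0 : 0 < #|clique G|.
  by apply/card_gt0P; exists set0; apply/cliqueP => u v; rewrite inE.
by have [Q cQ maxQ] := eq_bigmax_cond (fun Q => #|Q|) clique_gt0; exists Q.
Qed.

Lemma clique_sub_closed_neighbourhood Q x :
  clique G Q -> x \in Q -> Q \subset closed_neighbourhood x.
Proof.
move=> /cliqueP cQ xQ; apply/subsetP => v vQ; rewrite inE -implyNb eq_sym.
by apply/implyP; apply: cQ.
Qed.

Lemma clique_stable_eq Q I u v :
  clique G Q -> stable G I -> u \in Q -> v \in Q -> u \in I -> v \in I -> u = v.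
Proof.
move=> /cliqueP cQ /stableP sI uQ vQ uI vI.
by apply: contraNeq (sI u v uI vI); apply: cQ.
Qed.

Lemma independence_number_leq_clique_cover C :
  is_set_cover C -> {in C, forall A, clique G A} -> independence_number G <= #|C|.
Proof.
move=> coverC cliqueC; apply/bigmax_leqP => I sI.
have in_cover v : v \in cover C by rewrite coverC inE.
have block_inj : {in I &, injective (pblock C)}.
  move=> u v uI vI eq_uv; have cu := cliqueC _ (pblock_mem (in_cover u)).
  have vu : v \in pblock C u by rewrite eq_uv mem_pblock.
  by apply: (clique_stable_eq cu sI) => //; rewrite mem_pblock.
rewrite -(card_in_imset block_inj); apply/subset_leq_card/subsetP => _ /imsetP[v _ ->].
exact: pblock_mem.
Qed.

End CliquesAndStableSets.

Lemma KS_partition_setC (V : finType) (G : sgraph V) (K S : {set V}) :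
  KS_partition G K S -> K = ~: S.
Proof.
case=> /setP KS_V disjKS _ _; apply/setP => x; have := KS_V x.
by rewrite !inE; have [/(disjointFl disjKS)-> | _] := boolP (x \in S); rewrite ?orbF.
Qed.

Lemma card_KS_partition (V : finType) (G : sgraph V) (K S : {set V}) :
  KS_partition G K S -> #|K| + #|S| = #|V|.
Proof. by move/KS_partition_setC->; rewrite addnC cardsC. Qed.

Section KSPartition.

Variables (V : finType) (G : sgraph V) (K S : {set V}).
Hypothesis KS : KS_partition G K S.

Lemma KS_closed_neighbourhood_sub x :
  x \in S -> closed_neighbourhood G x \subset x |: K.
Proof.
case: KS => _ _ _ /stableP sS xS; apply/subsetP => v.
rewrite (KS_partition_setC KS) !inE.
by have [//|_ /=] := eqVneq v x; apply/contraTN/sS.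
Qed.

Lemma KS_full_closed_neighbourhood_clique x :
  x |: K \subset closed_neighbourhood G x -> clique G (x |: K).
Proof.
case: KS => _ _ /cliqueP cK _ /subsetP xK_nbr; apply/cliqueP => u v.
case/setU1P => [-> /xK_nbr | uK]; first by rewrite inE eq_sym => /orP[->|].
case/setU1P => [-> neq_ux | vK]; last exact: cK.
by have := xK_nbr u (setU1r x uK); rewrite inE (negPf neq_ux) adj_sym.
Qed.

Lemma KS_clique_number_gtP :
  reflect (exists2 x, x \in S & #|closed_neighbourhood G x| = #|K|.+1)
          (#|K| < clique_number G).
Proof.
have card_xK x : x \in S -> #|x |: K| = #|K|.+1.
  by move=> xS; rewrite cardsU1 {1}(KS_partition_setC KS) inE xS.
apply: (iffP idP) => [|[x xS card_nbr]].
  have [Q cQ <-] := exists_max_clique G; move=> ltKQ.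
  have /subsetPn[x xQ xNK] : ~~ (Q \subset K).
    by apply: contraL ltKQ => /subset_leq_card; rewrite -leqNgt.
  have xS : x \in S by move: xNK; rewrite (KS_partition_setC KS) inE negbK.
  exists x => //; apply/eqP; rewrite eqn_leq -{1}(card_xK x xS).
  rewrite subset_leq_card ?KS_closed_neighbourhood_sub //=.
  exact: leq_trans ltKQ (subset_leq_card (clique_sub_closed_neighbourhood cQ xQ)).
rewrite -(card_xK x xS); apply/leq_clique_number/KS_full_closed_neighbourhood_clique.
have nbr_xK : closed_neighbourhood G x == x |: K.
  by rewrite eqEcard KS_closed_neighbourhood_sub // card_nbr card_xK /=.
by rewrite (eqP nbr_xK).
Qed.

Lemma has_balanced_KS_partitionP :
  #|S| = independence_number G ->
  reflect (has_balanced_KS_partition G) (clique_number G <= #|K|).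
Proof.
have [_ _ cK _] := KS; move=> maxS.
apply: (iffP idP) => [omega_le | [K' [S' [KS' maxK' maxS']]]].
  by exists K, S; split=> //; apply/eqP; rewrite eqn_leq leq_clique_number.
rewrite -maxK' -(leq_add2r #|S|) (card_KS_partition KS) maxS -maxS'.
by rewrite (card_KS_partition KS').
Qed.

End KSPartition.

Section CoverGraphTheory.

Variables (V : finType) (C : {set {set V}}).
Implicit Types (A B K : {set V}) (x : V).

Lemma loyal_mem_eq A B x : loyal C A x -> B \in C -> x \in B -> B = A.
Proof. by case=> _ loyal_x BC; apply: contraTeq; apply: loyal_x. Qed.

Lemma cover_mem_clique K A : A \in C -> clique (cover_graph C K) A.
Proof.
move=> AC; apply/cliqueP => u v uA vA neq_uv; rewrite /= /cover_adj neq_uv.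
by apply/orP; left; apply/exists_inP; exists A; rewrite ?uA.
Qed.

Lemma cover_graph_clique K : clique (cover_graph C K) K.
Proof.
by apply/cliqueP => u v uK vK neq_uv; rewrite /= /cover_adj neq_uv uK vK orbT.
Qed.

Lemma loyal_closed_neighbourhood K A x :
  A \in C -> loyal C A x -> x \notin K ->
  closed_neighbourhood (cover_graph C K) x = A.
Proof.
move=> AC loyal_x xNK; have [xA _] := loyal_x; apply/eqP; rewrite eqEsubset.
rewrite clique_sub_closed_neighbourhood ?cover_mem_clique // andbT.
apply/subsetP => v; rewrite inE /= /cover_adj (negPf xNK) orbF.
case/orP => [/eqP-> // | /andP[_ /exists_inP[B BC /andP[xB vB]]]].
by rewrite -(loyal_mem_eq loyal_x BC xB).
Qed.

Section LoyalChoice.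

Local Notation member := {A : {set V} | A \in C}.

Variable s : member -> V.
Hypothesis loyal_s : forall A : member, loyal C (val A) (s A).

Local Notation S := [set s A | A : member].
Local Notation G := (cover_graph C (~: S)).

Lemma loyal_choice_inj : injective s.
Proof.
move=> A B eq_sAB; apply/esym/val_inj/(loyal_mem_eq (loyal_s A)).
  exact: valP.
by rewrite eq_sAB; case: (loyal_s B).
Qed.

Lemma card_loyal_choice : #|S| = #|C|.
Proof. by rewrite card_imset ?card_sig //; apply: loyal_choice_inj. Qed.

Lemma closed_neighbourhood_loyal_choice (A : member) :
  closed_neighbourhood G (s A) = val A.
Proof. by rewrite (loyal_closed_neighbourhood (valP A)) // inE negbK imset_f. Qed.

Lemma cover_graph_KS_partition : KS_partition G (~: S) S.
Proof.
split; first by rewrite setUC setUCr.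
- by rewrite disjoints_subset.
- exact: cover_graph_clique.
apply/stableP => _ _ /imsetP[A _ ->] /imsetP[B _ ->]; apply/negP => sAsB.
have sB_A : s B \in val A by rewrite -closed_neighbourhood_loyal_choice inE sAsB orbT.
have eqAB : A = B by apply/val_inj/(loyal_mem_eq (loyal_s B)) => //; apply: valP.
by move: sAsB; rewrite eqAB adj_irr.
Qed.

Lemma cover_graph_independence_number :
  is_set_cover C -> independence_number G = #|S|.
Proof.
move=> coverC; apply/eqP; rewrite eqn_leq {1}card_loyal_choice.
rewrite (independence_number_leq_clique_cover coverC (@cover_mem_clique _)).
by rewrite leq_independence_number //; case: cover_graph_KS_partition.
Qed.

Lemma has_unbalancing_setP :
  reflect (has_unbalancing_set C) (#|~: S| < clique_number G).
Proof.
have cardK : #|~: S|.+1 = #|V| - #|C| + 1.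
  by rewrite cardsCs setCK card_loyal_choice addn1.
apply: (iffP (KS_clique_number_gtP cover_graph_KS_partition)).
  case=> _ /imsetP[A _ ->].
  by rewrite closed_neighbourhood_loyal_choice cardK; exists (val A); first exact: valP.
case=> A AC cardA; pose M : member := Sub A AC; exists (s M); first exact: imset_f.
by rewrite closed_neighbourhood_loyal_choice cardK.
Qed.

End LoyalChoice.

End CoverGraphTheory.

Theorem theorem2p7 (V : finType) (C : {set {set V}})
    (s : {A : {set V} | A \in C} -> V) :
  minimal_set_cover C ->
  (forall A : {A : {set V} | A \in C}, loyal C (val A) (s A)) ->
  let S : {set V} := [set s A | A : {A : {set V} | A \in C}] in
  let K : {set V} := ~: S in
  let G : sgraph V := cover_graph C K in
  [/\ split_graph G,
      unbalanced_split_graph G <-> unbalanced_cover C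
    & balanced_split_graph G <-> balanced_cover C].
Proof.
move=> minC loyal_s S K G; have [coverC _] := minC.
have KS : KS_partition G K S := cover_graph_KS_partition loyal_s.
have maxS : #|S| = independence_number G.
  exact/esym/cover_graph_independence_number.
have splitG : split_graph G by exists K, S.
have balP : reflect (has_balanced_KS_partition G) (clique_number G <= #|K|).
  exact: has_balanced_KS_partitionP KS maxS.
have unbP : reflect (has_unbalancing_set C) (#|K| < clique_number G).
  exact: has_unbalancing_setP.
have [omega_gt | omega_le] := ltnP #|K| (clique_number G).
- have unbC : has_unbalancing_set C by apply/unbP.
  have nbalG : ~ has_balanced_KS_partition G by move=> /balP; rewrite leqNgt omega_gt.
  by split=> //; split=> -[].
- have balG : has_balanced_KS_partition G by apply/balP.
  have nunbC : ~ has_unbalancing_set C by move=> /unbP; rewrite ltnNge omega_le.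
  by split=> //; split=> -[].
Qed.
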